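(* Let $\Sigma_1, \Sigma_2 : \mathbf{L}_{2e} \to \mathbf{L}_{2e}$ be causal systems for which the feedback interconnection $\Sigma_1 \| \Sigma_2$ is well-posed. Then $\Sigma_1 \| \Sigma_2$ is passive if and only if both $\Sigma_1$ and $\Sigma_2$ are passive.
   Context: Fix a dimension $n$. $\mathbf{L}_2$ is the set of $v:[0,\infty)\to\mathbb{R}^n$ that are Lebesgue square-integrable, with $\|v\|_2^2 = \langle v,v\rangle = \int_0^\infty v(t)^T v(t)\,dt$. For $T\ge 0$ the truncation operator is $(P_T v)(t) = v(t)$ for $t\in[0,T)$ and $0$ otherwise. $\mathbf{L}_{2e}$ is the set of $v:[0,\infty)\to\mathbb{R}^n$ with $P_T v\in \mathbf{L}_2$ for all $T\in[0,\infty)$. (The dimension is suppressed; the same notation is used for stacked signals such as $(e_1,e_2)$.) A system is a (possibly nonlinear) map $\Delta:\mathbf{L}_{2e}\to\mathbf{L}_{2e}$. It is causal if $P_T\Delta P_T = P_T\Delta$ for all $T\ge 0$. It is passive if $\inf_{T>0,\,u\in\mathbf{L}_{2e}} \int_0^T u(t)^T(\Delta u)(t)\,dt \ge 0$. The feedback interconnection $\Sigma_1\|\Sigma_2$ of causal systems $\Sigma_1,\Sigma_2:\mathbf{L}_{2e}\to\mathbf{L}_{2e}$ is described by $$u_1 = e_1 - y_2,\quad u_2 = e_2 + y_1,\quad y_1 = \Sigma_1 u_1,\quad y_2 = \Sigma_2 u_2.$$ It is well-posed if the correspondence $(y_1,y_2)\mapsto(e_1,e_2)$ defined by these equations has a causal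 inverse $F$ on $\mathbf{L}_{2e}$, i.e. for every $(e_1,e_2)\in\mathbf{L}_{2e}$ there is exactly one $(y_1,y_2)\in\mathbf{L}_{2e}$ for which the equations hold, and the resulting map $F:(e_1,e_2)\mapsto(y_1,y_2)$ is causal. A well-posed $\Sigma_1\|\Sigma_2$ is passive if the map $(e_1,e_2)\mapsto(y_1,y_2)$ is passive, i.e. $\inf_{T>0,\,e_1,e_2\in\mathbf{L}_{2e}}\int_0^T e_1(t)^Ty_1(t)+e_2(t)^Ty_2(t)\,dt\ge 0$. *)

(* Defs.v *)
From HB Require Import structures.
From mathcomp Require Import all_boot all_order all_algebra.
From mathcomp Require Import all_classical all_reals all_analysis.
From mathcomp Require Import measurable_realfun ring lra.

Set Implicit Arguments.
Unset Strict Implicit.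
Unset Printing Implicit Defensive.

Import Order.TTheory GRing.Theory Num.Theory.
Local Open Scope classical_set_scope.
Local Open Scope ring_scope.
Local Open Scope quotient_scope.

Section Functions.
Variables (R : realType) (n : nat).
Implicit Types v w : R -> 'cV[R]_n.

Definition dot v w (t : R) : R := ((v t)^T *m w t) 0 0.

Definition trunc (T : R) v : R -> 'cV[R]_n :=
  fun t => if 0 <= t < T then v t else 0.

(* The time axis is the subset [0, +oo[ of R; values at negative times are
   junk, discarded by the quotient L2e below.  Measurability is with respect to
   the Borel sigma-algebra: every Lebesgue-measurable signal is a.e. equal to a
   Borel one, so after the quotient this is no restriction. *)
Definition square_integrable v : Prop :=
  (forall i, measurable_fun (`[0, +oo[ : set R) (fun t => v t i 0)) /\
  (\int[@lebesgue_measure R]_(t in `[0%R, +oo[) (dot v v t)%:E < +oo)%E.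

Definition locally_square_integrable : {pred R -> 'cV[R]_n} :=
  fun v => `[< forall T, 0 <= T -> square_integrable (trunc T v) >].

Lemma dotE v w t : dot v w t = \sum_i v t i 0 * w t i 0.
Proof. by rewrite /dot mxE; apply: eq_bigr => i _; rewrite mxE. Qed.

Lemma dot_ge0 v t : 0 <= dot v v t.
Proof. by rewrite dotE; apply: sumr_ge0 => i _; rewrite -expr2 sqr_ge0. Qed.

Lemma measurable_dot (D : set R) v w :
  (forall i, measurable_fun D (fun t => v t i 0)) ->
  (forall i, measurable_fun D (fun t => w t i 0)) ->
  measurable_fun D (dot v w).
Proof.
move=> mv mw; rewrite (_ : dot v w = fun t => \sum_i v t i 0 * w t i 0).
  by apply: measurable_sum => i; apply: measurable_funM.
by apply/funext => t; rewrite dotE.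
Qed.

End Functions.

Lemma square_integrable_le (R : realType) (n m p : nat)
    (u : R -> 'cV[R]_n) (v : R -> 'cV[R]_m) (w : R -> 'cV[R]_p) :
  (forall i, measurable_fun (`[0, +oo[ : set R) (fun t => u t i 0)) ->
  (forall t, dot u u t <= 2 * dot v v t + 2 * dot w w t) ->
  square_integrable v -> square_integrable w -> square_integrable u.
Proof.
move=> mu le_u [mv iv] [mw iw]; split=> //.
have mdot q (z : R -> 'cV[R]_q) :
    (forall i, measurable_fun (`[0, +oo[ : set R) (fun t => z t i 0)) ->
    measurable_fun (`[0, +oo[ : set R) (fun t => (dot z z t)%:E).
  by move=> mz; apply/measurable_EFinP; exact: measurable_dot.
have d0 q (z : R -> 'cV[R]_q) t : (0 <= (dot z z t)%:E)%E.
  by rewrite lee_fin dot_ge0.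
have two0 : (0 <= 2%:E :> \bar R)%E by rewrite lee_fin.
apply: (@le_lt_trans _ _ (\int[@lebesgue_measure R]_(t in `[0%R, +oo[)
    (2%:E * (dot v v t)%:E + 2%:E * (dot w w t)%:E))%E).
  apply: ge0_le_integral => //=; first exact: mdot.
  - by apply: emeasurable_funD; apply: measurable_funeM; exact: mdot.
  - by move=> t _; rewrite -!EFinM -EFinD lee_fin le_u.
rewrite ge0_integralD//=.
- rewrite !ge0_integralZl//=; try exact: mdot.
  by rewrite lte_add_pinfty// lte_mul_pinfty.
- by move=> t _; rewrite mule_ge0.
- by apply: measurable_funeM; exact: mdot.
- by move=> t _; rewrite mule_ge0.
- by apply: measurable_funeM; exact: mdot.
Qed.

Section Signals.
Variables (R : realType) (n : nat).

Lemma square_integrable0 : square_integrable (fun _ : R => 0 : 'cV[R]_n).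
Proof.
split=> [i|].
  apply: (eq_measurable_fun (cst 0 : R -> R)); last exact: measurable_cst.
  by move=> t _; rewrite /= mxE.
rewrite integral0_eq ?ltry// => t _.
by rewrite dotE big1// => i _; rewrite mxE mul0r.
Qed.

Fact locally_square_integrable_zmod_closed :
  zmod_closed (@locally_square_integrable R n).
Proof.
split=> [|v w /asboolP hv /asboolP hw]; apply/asboolP => T T0.
  rewrite (_ : trunc T _ = fun _ => 0); first exact: square_integrable0.
  by apply/funext => t; rewrite /trunc; case: ifP.
have [[mv iv] [mw iw]] := (hv T T0, hw T T0).
have E t : trunc T (v - w) t = trunc T v t - trunc T w t.
  by rewrite /trunc; case: ifP; rewrite ?subr0.
apply: (square_integrable_le _ _ (hv T T0) (hw T T0)) => [i|t].
  apply: (eq_measurable_fun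
    (((fun t => trunc T v t i 0) \- (fun t => trunc T w t i 0)) : R -> R)).
    by move=> t _; rewrite /= E !mxE.
  by apply: measurable_funB.
rewrite !dotE !mulr_sumr -big_split/=; apply: ler_sum => i _.
rewrite E !mxE; set a := trunc T v t i 0; set b := trunc T w t i 0.
rewrite -subr_ge0 (_ : _ - _ = (a + b) ^+ 2) ?sqr_ge0//.
by ring.
Qed.

HB.instance Definition _ := GRing.isZmodClosed.Build (R -> 'cV[R]_n)
  (@locally_square_integrable R n) locally_square_integrable_zmod_closed.

Record lsi_fun := LsiFun {
  lsi_val :> R -> 'cV[R]_n;
  lsi_valP : lsi_val \in @locally_square_integrable R n }.

HB.instance Definition _ := [isSub for lsi_val].
HB.instance Definition _ := [Choice of lsi_fun by <:].
HB.instance Definition _ := [SubChoice_isSubZmodule of lsi_fun by <:].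

Definition ae_null : {pred lsi_fun} :=
  fun v => `[< {ae @lebesgue_measure R, forall t, 0 <= t -> v t = 0} >].

Fact ae_null_zmod_closed : zmod_closed ae_null.
Proof.
split=> [|v w /asboolP hv /asboolP hw]; apply/asboolP.
  by apply: aeW => t _.
have F := ae_filter_ringOfSetsType (@lebesgue_measure R).
apply: (@filterS2 _ _ F _ _ _ _ hv hw) => t vt wt t0.
by rewrite -[LHS]/(v t - w t) vt// wt// subr0.
Qed.

HB.instance Definition _ := GRing.isZmodClosed.Build lsi_fun ae_null
  ae_null_zmod_closed.

(* Signals are identified when they agree almost everywhere on [0, +oo[; the
   group structure is that of the quotient of lsi_fun by the subgroup ae_null. *)
Definition L2e := Quotient.quot ae_null.
HB.instance Definition _ := GRing.Zmodule.on L2e.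
HB.instance Definition _ := EqQuotient.on L2e.

Lemma L2e_eqP (v w : lsi_fun) :
  \pi_L2e v = \pi_L2e w <->
  {ae @lebesgue_measure R, forall t, 0 <= t -> v t = w t}.
Proof.
have F := ae_filter_ringOfSetsType (@lebesgue_measure R).
have -> : \pi_L2e v = \pi_L2e w <-> v - w \in ae_null.
  by rewrite (Quotient.idealrBE ae_null v w); split=> /eqP.
split=> [/asboolP|] h; last apply/asboolP.
  by apply: filterS h => t h t0; apply/eqP; rewrite -subr_eq0 -(h t0).
by apply: filterS h => t h t0; rewrite -[LHS]/(v t - w t) h// subrr.
Qed.

End Signals.

Section Operations.
Variable R : realType.

Fact trunc_lsi n (T : R) (v : lsi_fun R n) :
  trunc T v \in @locally_square_integrable R n.
Proof.
apply/asboolP => S S0; have /asboolP hv := lsi_valP v.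
rewrite (_ : trunc S _ = trunc (Num.max 0 (Num.min S T)) v).
  by apply: hv; rewrite le_max lexx.
apply/funext => t; rewrite /trunc lt_max lt_min.
by case: (leP 0 t) => //= _; case: (t < S).
Qed.

Definition lsi_trunc n (T : R) v : lsi_fun R n := LsiFun (trunc_lsi T v).

Definition P_ n (T : R) (v : L2e R n) : L2e R n :=
  \pi_(L2e R n) (lsi_trunc T (repr v)).

Lemma P_pi n (T : R) (v : lsi_fun R n) :
  P_ T (\pi_(L2e R n) v) = \pi_(L2e R n) (lsi_trunc T v).
Proof.
have F := ae_filter_ringOfSetsType (@lebesgue_measure R).
apply/L2e_eqP; have /L2e_eqP := reprK (\pi_(L2e R n) v).
by apply: filterS => t h t0; rewrite /= /trunc; case: ifP => // _; exact: h.
Qed.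

Variables m n : nat.

(* Stacked signals: the inner product of (e1, e2) and (y1, y2) is
   e1^T y1 + e2^T y2. *)
Lemma dot_col_mx (v v' : R -> 'cV[R]_m) (w w' : R -> 'cV[R]_n) t :
  dot (fun t => col_mx (v t) (w t)) (fun t => col_mx (v' t) (w' t)) t =
  dot v v' t + dot w w' t.
Proof. by rewrite /dot tr_col_mx mul_row_col mxE. Qed.

Fact stack_lsi (v : lsi_fun R m) (w : lsi_fun R n) :
  (fun t => col_mx (v t) (w t)) \in @locally_square_integrable R (m + n).
Proof.
apply/asboolP => T T0.
have /asboolP/(_ T T0) hv := lsi_valP v.
have /asboolP/(_ T T0) hw := lsi_valP w.
rewrite (_ : trunc T _ = fun t => col_mx (trunc T v t) (trunc T w t)); last first.
  by apply/funext => t; rewrite /trunc; case: ifP; rewrite ?col_mx0.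
apply: (square_integrable_le _ _ hv hw) => [i|t].
  case: (splitP i) => j ij.
    have -> : i = lshift n j by exact: val_inj.
    apply: (eq_measurable_fun ((fun t => trunc T v t j 0) : R -> R)).
      by move=> t _; rewrite /= col_mxEu.
    by have [mv _] := hv; exact: mv.
  have -> : i = rshift m j by exact: val_inj.
  apply: (eq_measurable_fun ((fun t => trunc T w t j 0) : R -> R)).
    by move=> t _; rewrite /= col_mxEd.
  by have [mw _] := hw; exact: mw.
by rewrite dot_col_mx lerD// ler_peMl ?dot_ge0// ler1n.
Qed.

Fact usub_lsi (v : lsi_fun R (m + n)) :
  (fun t => usubmx (v t)) \in @locally_square_integrable R m.
Proof.
apply/asboolP => T T0; have /asboolP/(_ T T0) hv := lsi_valP v.
rewrite (_ : trunc T _ = fun t => usubmx (trunc T v t)); last first.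
  by apply/funext => t; rewrite /trunc; case: ifP; rewrite ?linear0.
apply: (square_integrable_le _ _ hv hv) => [i|t].
  apply: (eq_measurable_fun ((fun t => trunc T v t (lshift n i) 0) : R -> R)).
    by move=> t _; rewrite /= mxE.
  by have [mv _] := hv; exact: mv.
have d0 := dot_ge0.
set u := trunc T v.
have -> : dot u u t = dot (fun t => usubmx (u t)) (fun t => usubmx (u t)) t +
                      dot (fun t => dsubmx (u t)) (fun t => dsubmx (u t)) t.
  by rewrite -dot_col_mx /dot vsubmxK.
have := d0 R m (fun t => usubmx (u t)) t.
have := d0 R n (fun t => dsubmx (u t)) t.
lra.
Qed.

Fact dsub_lsi (v : lsi_fun R (m + n)) :
  (fun t => dsubmx (v t)) \in @locally_square_integrable R n.
Proof.
apply/asboolP => T T0; have /asboolP/(_ T T0) hv := lsi_valP v.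
rewrite (_ : trunc T _ = fun t => dsubmx (trunc T v t)); last first.
  by apply/funext => t; rewrite /trunc; case: ifP; rewrite ?linear0.
apply: (square_integrable_le _ _ hv hv) => [i|t].
  apply: (eq_measurable_fun ((fun t => trunc T v t (rshift m i) 0) : R -> R)).
    by move=> t _; rewrite /= mxE.
  by have [mv _] := hv; exact: mv.
have d0 := dot_ge0.
set u := trunc T v.
have -> : dot u u t = dot (fun t => usubmx (u t)) (fun t => usubmx (u t)) t +
                      dot (fun t => dsubmx (u t)) (fun t => dsubmx (u t)) t.
  by rewrite -dot_col_mx /dot vsubmxK.
have := d0 R m (fun t => usubmx (u t)) t.
have := d0 R n (fun t => dsubmx (u t)) t.
lra.
Qed.

Definition lsi_stack v w : lsi_fun R (m + n) := LsiFun (stack_lsi v w).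
Definition lsi_usub v : lsi_fun R m := LsiFun (usub_lsi v).
Definition lsi_dsub v : lsi_fun R n := LsiFun (dsub_lsi v).

Definition stack (v : L2e R m) (w : L2e R n) : L2e R (m + n) :=
  \pi_(L2e R (m + n)) (lsi_stack (repr v) (repr w)).
Definition fst_signal (v : L2e R (m + n)) : L2e R m :=
  \pi_(L2e R m) (lsi_usub (repr v)).
Definition snd_signal (v : L2e R (m + n)) : L2e R n :=
  \pi_(L2e R n) (lsi_dsub (repr v)).

Lemma stack_pi (v : lsi_fun R m) (w : lsi_fun R n) :
  stack (\pi_(L2e R m) v) (\pi_(L2e R n) w) =
  \pi_(L2e R (m + n)) (lsi_stack v w).
Proof.
have F := ae_filter_ringOfSetsType (@lebesgue_measure R).
apply/L2e_eqP; have /L2e_eqP hv := reprK (\pi_(L2e R m) v).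
have /L2e_eqP hw := reprK (\pi_(L2e R n) w).
by apply: (@filterS2 _ _ F _ _ _ _ hv hw) => t vt wt t0 /=; rewrite vt ?wt.
Qed.

Lemma fst_signal_pi (v : lsi_fun R (m + n)) :
  fst_signal (\pi_(L2e R (m + n)) v) = \pi_(L2e R m) (lsi_usub v).
Proof.
have F := ae_filter_ringOfSetsType (@lebesgue_measure R).
apply/L2e_eqP; have /L2e_eqP := reprK (\pi_(L2e R (m + n)) v).
by apply: filterS => t vt t0 /=; rewrite vt.
Qed.

Lemma snd_signal_pi (v : lsi_fun R (m + n)) :
  snd_signal (\pi_(L2e R (m + n)) v) = \pi_(L2e R n) (lsi_dsub v).
Proof.
have F := ae_filter_ringOfSetsType (@lebesgue_measure R).
apply/L2e_eqP; have /L2e_eqP := reprK (\pi_(L2e R (m + n)) v).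
by apply: filterS => t vt t0 /=; rewrite vt.
Qed.

Lemma fst_stack (v : L2e R m) (w : L2e R n) : fst_signal (stack v w) = v.
Proof.
rewrite fst_signal_pi -[RHS]reprK; congr (\pi_(_) _); apply: val_inj.
by apply/funext => t /=; rewrite col_mxKu.
Qed.

Lemma snd_stack (v : L2e R m) (w : L2e R n) : snd_signal (stack v w) = w.
Proof.
rewrite snd_signal_pi -[RHS]reprK; congr (\pi_(_) _); apply: val_inj.
by apply/funext => t /=; rewrite col_mxKd.
Qed.

Lemma stack_fst_snd (v : L2e R (m + n)) :
  stack (fst_signal v) (snd_signal v) = v.
Proof.
rewrite stack_pi -[RHS]reprK; congr (\pi_(_) _); apply: val_inj.
by apply/funext => t /=; rewrite vsubmxK.
Qed.

End Operations.

Section Systems.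
Variable R : realType.

Definition system n := L2e R n -> L2e R n.

Definition causal n (D : system n) : Prop :=
  forall T : R, 0 <= T -> P_ T \o D \o P_ T = P_ T \o D.

(* The integral does not depend on the representatives. It is finite, since
   both signals are square-integrable on [0, T]. *)
Definition inner_upto n (T : R) (u y : L2e R n) : \bar R :=
  (\int[@lebesgue_measure R]_(t in `[0%R, T]) (dot (repr u) (repr y) t)%:E)%E.

Definition passive n (D : system n) : Prop :=
  (0 <= ereal_inf [set z | exists (T : R) (u : L2e R n),
                      (0 < T)%R /\ z = inner_upto T u (D u)])%E.

Variables (n : nat) (S1 S2 : system n).

Definition feedback (e1 e2 y1 y2 : L2e R n) : Prop :=
  exists u1 u2, [/\ u1 = e1 - y2, u2 = e2 + y1, y1 = S1 u1 & y2 = S2 u2].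

Definition outputs (e : L2e R (n + n)) : set (L2e R (n + n)) :=
  [set y | feedback (fst_signal e) (snd_signal e)
                    (fst_signal y) (snd_signal y)].

(* The default 0 is taken only where [outputs] is empty, which well-posedness
   excludes. *)
Definition closed_loop : system (n + n) :=
  fun e => xget 0 (outputs e).

Definition well_posed : Prop :=
  (forall e, exists! y, outputs e y) /\ causal closed_loop.

End Systems.

(* Main.v *)
Require Import Defs.
From mathcomp Require Import all_boot all_order all_algebra.
From mathcomp Require Import all_classical all_reals all_analysis.
From mathcomp Require Import measurable_realfun ring lra.

(** The interconnection moves energy around without creating any.  Writing the
    external signals through the internal ones, [e1 = u1 + y2] and
    [e2 = u2 - y1], the cross terms [y2^T y1] and [- y1^T y2] cancel, so that
    [e1^T y1 + e2^T y2 = u1^T y1 + u2^T y2] ([inner_upto_feedback]).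

    Well-posedness makes the internal signals [(u1, u2)] as free as the external
    ones: every external signal comes from some [(u1, u2)], and every pair
    [(u1, u2)] is realised by the external signal displayed above, to which
    uniqueness forces the closed loop to answer [(S1 u1, S2 u2)].  Hence the
    closed loop is passive exactly when the sum of the energies absorbed by the
    two systems is nonnegative for all independent inputs
    ([passive_closed_loopP]).  Two passive systems clearly satisfy this;
    conversely a system fed with the zero input absorbs no energy, whatever its
    output, so putting one of the inputs to zero isolates the other system. *)

Set Implicit Arguments.
Unset Strict Implicit.
Unset Printing Implicit Defensive.

Import Order.TTheory GRing.Theory Num.Theory.
Local Open Scope classical_set_scope.
Local Open Scope ring_scope.
Local Open Scope quotient_scope.

Section InnerProduct.
Variables (R : realType) (n : nat).
Implicit Types (T : R) (v w : lsi_fun R n).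

Lemma measurable_lsi T v i :
  measurable_fun (`[0, T] : set R) (fun t => v t i 0).
Proof.
have [T0|T0] := ltP T 0.
  by rewrite set_itv_ge ?bnd_simp -?ltNge//; exact: measurable_fun_set0.
(* Truncation at [T + 1]: truncating at [T] would lose the endpoint of the
   closed interval. *)
have T10 : 0 <= T + 1 by rewrite addr_ge0.
have /asboolP/(_ _ T10) [mv _] := lsi_valP v.
apply: (eq_measurable_fun (fun t => trunc (T + 1) v t i 0)).
  move=> t; rewrite inE/= in_itv/= => /andP[t0 tT].
  by rewrite /trunc t0 (le_lt_trans tT) ?ltrDl.
apply: measurable_funS (mv i) => //.
by move=> t /=; rewrite !in_itv/= andbT => /andP[].
Qed.

Lemma measurable_dot_lsi T v w :
  measurable_fun (`[0, T] : set R) (fun t => (dot v w t)%:E).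
Proof.
by apply/measurable_EFinP; apply: measurable_dot => i; exact: measurable_lsi.
Qed.

Lemma integrable_dot_self T v :
  (@lebesgue_measure R).-integrable `[0, T] (fun t => (dot v v t)%:E).
Proof.
have [T0|T0] := ltP T 0.
  by rewrite set_itv_ge ?bnd_simp -?ltNge//; exact: integrable_set0.
have T10 : 0 <= T + 1 by rewrite addr_ge0.
have /asboolP/(_ _ T10) [mv iv] := lsi_valP v.
apply/integrableP; split; first exact: measurable_dot_lsi.
apply: le_lt_trans iv.
apply: (@le_trans _ _ (\int[@lebesgue_measure R]_(t in `[0%R, T])
    (dot (trunc (T + 1) v) (trunc (T + 1) v) t)%:E)%E).
  rewrite le_eqVlt; apply/orP; left; apply/eqP.
  apply: eq_integral => t; rewrite inE/= in_itv/= => /andP[t0 tT].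
  by rewrite ger0_norm ?dot_ge0// /dot /trunc t0 (le_lt_trans tT) ?ltrDl.
apply: ge0_subset_integral => //.
- by apply/measurable_EFinP; exact: measurable_dot.
- by move=> t _; rewrite lee_fin dot_ge0.
- by move=> t /=; rewrite !in_itv/= andbT => /andP[].
Qed.

(** Locally square-integrable signals have a locally integrable product, since
    [|v^T w| <= v^T v + w^T w]; this is what makes the supplied energy finite,
    hence additive. *)
Lemma integrable_dot T v w :
  (@lebesgue_measure R).-integrable `[0, T] (fun t => (dot v w t)%:E).
Proof.
apply: (le_integrable _ _ _
  (integrableD _ (integrable_dot_self T v) (integrable_dot_self T w))) => //.
  exact: measurable_dot_lsi.
move=> t _ /=; rewrite lee_fin [leRHS]ger0_norm ?addr_ge0 ?dot_ge0//.
rewrite !dotE -big_split/=; apply: le_trans (ler_norm_sum _ _ _) _.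
apply: ler_sum => i _; set a := v t i 0; set b := w t i 0.
by rewrite ler_norml; apply/andP; split; nra.
Qed.

(** Frees computations from the canonical representatives chosen by [repr],
    which are compatible with sums and stacking only almost everywhere. *)
Lemma inner_upto_pi T v w :
  inner_upto T (\pi_(L2e R n) v) (\pi_(L2e R n) w) =
  (\int[@lebesgue_measure R]_(t in `[0%R, T]) (dot v w t)%:E)%E.
Proof.
have F := ae_filter_ringOfSetsType (@lebesgue_measure R).
rewrite /inner_upto; apply: ae_eq_integral => //.
- exact: measurable_dot_lsi.
- exact: measurable_dot_lsi.
have /L2e_eqP hv := reprK (\pi_(L2e R n) v).
have /L2e_eqP hw := reprK (\pi_(L2e R n) w).
apply: (@filterS2 _ _ F _ _ _ _ hv hw) => t vt wt.
by rewrite /= in_itv/= => /andP[t0 _]; rewrite /dot vt// wt.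
Qed.

Lemma inner_upto0 T (y : L2e R n) : inner_upto T 0 y = 0%E.
Proof.
rewrite -[y]reprK.
have -> : 0 = \pi_(L2e R n) 0 by rewrite !piE.
rewrite inner_upto_pi.
by apply: integral0_eq => t _; rewrite /dot linear0 mul0mx mxE.
Qed.

End InnerProduct.

(** Conservation of energy in the loop: each system receives minus or plus the
    output of the other, so the energy that one draws from the coupling is the
    energy that the other supplies. *)
Lemma inner_upto_feedback (R : realType) (n : nat) (T : R)
    (u1 u2 y1 y2 : L2e R n) :
  inner_upto T (stack (u1 + y2) (u2 - y1)) (stack y1 y2) =
  (inner_upto T u1 y1 + inner_upto T u2 y2)%E.
Proof.
rewrite -[u1]reprK -[u2]reprK -[y1]reprK -[y2]reprK.
move: (repr u1) (repr u2) (repr y1) (repr y2) => {}u1 {}u2 {}y1 {}y2.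
have -> : \pi_(L2e R n) u1 + \pi_(L2e R n) y2 = \pi_(L2e R n) (u1 + y2).
  by rewrite !piE.
have -> : \pi_(L2e R n) u2 - \pi_(L2e R n) y1 = \pi_(L2e R n) (u2 - y1).
  by rewrite !piE.
rewrite !stack_pi !inner_upto_pi -integralD//; try exact: integrable_dot.
apply: eq_integral => t _ /=; rewrite -EFinD; congr _%:E.
rewrite dot_col_mx !dotE -!big_split/=; apply: eq_bigr => i _.
rewrite !fctE !mxE.
by ring.
Qed.

Lemma passiveP (R : realType) (n : nat) (D : system R n) :
  passive D <-> forall T u, (0 < T)%R -> (0 <= inner_upto T u (D u))%E.
Proof.
split=> [D0 T u T0|D0].
  by apply: le_trans D0 _; apply: ereal_inf_lbound; exists T, u.
by apply: le_ereal_inf_tmp => _ [T [u [T0 ->]]]; exact: D0.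
Qed.

Section Passivity.
Variables (R : realType) (n : nat) (S1 S2 : system R n).
Hypothesis wp : well_posed S1 S2.

Lemma closed_loopP e : outputs S1 S2 e (closed_loop S1 S2 e).
Proof. by have [y [ey _]] := wp.1 e; exact: (xgetPex 0 (ex_intro _ y ey)). Qed.

(** The external signal is chosen to make the internal inputs equal to
    [(u1, u2)]; no other response is possible, by uniqueness. *)
Lemma closed_loop_internal u1 u2 :
  closed_loop S1 S2 (stack (u1 + S2 u2) (u2 - S1 u1)) = stack (S1 u1) (S2 u2).
Proof.
set e := stack _ _; have [y [_ uniq_y]] := wp.1 e.
rewrite -(uniq_y _ (closed_loopP e)); apply: uniq_y.
rewrite /outputs /= !fst_stack !snd_stack.
by exists u1, u2; rewrite addrK subrK.
Qed.

(** The internal inputs of the response that well-posedness provides. *)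
Lemma external_internal e :
  exists u1 u2, e = stack (u1 + S2 u2) (u2 - S1 u1).
Proof.
have [u1 [u2 [E1 E2 Y1 Y2]]] := closed_loopP e.
exists u1, u2; rewrite -Y1 -Y2 {1}E1 {1}E2 subrK addrK.
by rewrite stack_fst_snd.
Qed.

Lemma passive_closed_loopP :
  passive (closed_loop S1 S2) <->
  forall T u1 u2, (0 < T)%R ->
    (0 <= inner_upto T u1 (S1 u1) + inner_upto T u2 (S2 u2))%E.
Proof.
split=> [/passiveP S0 T u1 u2 T0|S0].
  by rewrite -inner_upto_feedback -closed_loop_internal; exact: S0.
apply/passiveP => T e T0; have [u1 [u2 ->]] := external_internal e.
by rewrite closed_loop_internal inner_upto_feedback; exact: S0.
Qed.

End Passivity.

Theorem theorem3 (R : realType) (n : nat) (S1 S2 : system R n) :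
  causal S1 -> causal S2 -> well_posed S1 S2 ->
  (passive (closed_loop S1 S2) <-> passive S1 /\ passive S2).
Proof.
move=> _ _ wp.
split=> [/(passive_closed_loopP wp) S0|[/passiveP p1 /passiveP p2]].
  split; apply/passiveP => T u T0.
    by have := S0 T u 0 T0; rewrite inner_upto0 adde0.
  by have := S0 T 0 u T0; rewrite inner_upto0 add0e.
apply/(passive_closed_loopP wp) => T u1 u2 T0.
by rewrite adde_ge0 ?p1 ?p2.
Qed.
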